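(* Assume the standing setting described in the context. Then there exists a constant $C>0$ such that $$\phi(x)\underset{x\to0}{\sim}C\,e^{\Lambda(x)},\qquad\text{where }\Lambda(x):=\int_1^x\frac{\lambda+B(y)}{\tau(y)}\,dy .$$
   Context: Standing setting. (1) The fragmentation coefficient is $b(x,y)=B(x)\frac1x\,p\!\left(\frac yx\right)$ for $x\ge y\ge0$, $x>0$, where $B:(0,+\infty)\to(0,+\infty)$ is locally integrable and $p$ is a nonnegative finite measure on $[0,1]$ (written as a function; integrals include the endpoints) with $\int_0^1 z\,p(z)\,dz=1$ and $\int_0^1p(z)\,dz>1$. Thus $\int_0^x b(x,y)f(y)\,dy=B(x)\int_0^1 f(xz)\,p(z)\,dz$ and $\int_x^\infty b(y,x)g(y)\,dy=\int_0^1 B(x/z)\,g(x/z)\,p(z)\,\frac{dz}{z}$. (2) $\tau:(0,+\infty)\to(0,+\infty)$ is continuous. (3) For some constants $B_0,B_\infty,\tau_0,\tau_\infty>0$ and $\gamma_0,\gamma,\alpha_0,\alpha\in\mathbb{R}$: $B(x)\sim B_0x^{\gamma_0}$ and $\tau(x)\sim\tau_0x^{\alpha_0}$ as $x\to0$; $B(x)\sim B_\infty x^{\gamma}$ and $\tau(x)\sim\tau_\infty x^{\alpha}$ as $x\to+\infty$; and $\gamma_0-\alpha_0+1>0$, $\gamma-\alpha+1>0$. (4) There exist $p_0\ge0$ and $\mu>0$ with $p(z)=p_0z^{\mu-1}+o(z^{\mu-1})$ as $z\to0$ (in particular $p$ coincides with a function near $0$), and $\mu-\alpha_0+1>0$.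 Profiles. Let $\mathcal{L}g(x)=\int_x^\infty b(y,x)g(y)\,dy-B(x)g(x)$. Under (1)–(4) it is known that there is a unique solution $(\lambda,G,\phi)$, with $\lambda>0$ (the largest eigenvalue of $g\mapsto-(\tau g)'+\mathcal{L}g$), of the eigenproblem $$(\tau G)'+\lambda G=\mathcal{L}G,\quad \tau(x)G(x)\big|_{x=0}=0,\quad G\ge0,\quad \int_0^\infty G\,dx=1,$$ $$-\tau\phi'+(B+\lambda)\phi=\int_0^x b(x,y)\phi(y)\,dy,\quad \phi\ge0,\quad\int_0^\infty G\phi\,dx=1 .$$ $\lambda$, $G$, $\phi$ always denote this solution.
   Formalization: The solution (λ,G,φ) is also required to satisfy φ(x) ≤ K(1+x^k) for some K and k≥0, the bound of the known existence theorem; without it the displayed eigenproblem can have further solutions with φ unbounded at 0, for which the claim fails. *)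

(* Defs.v *)
From HB Require Import structures.
From mathcomp Require Import all_boot all_order all_algebra.
From mathcomp Require Import all_classical all_reals all_analysis.

Set Implicit Arguments.
Unset Strict Implicit.
Unset Printing Implicit Defensive.

Import Order.TTheory GRing.Theory Num.Theory.
Import numFieldNormedType.Exports.

Local Open Scope classical_set_scope.
Local Open Scope ring_scope.

(* Makes Landau notations available at +oo. *)
Canonical pinfty_filter_on (R : numFieldType) :=
  FilterType (pinfty_nbhs R) (@filter_filter R _ proper_pinfty_nbhs).

(* All functions on (0, +oo) are total functions R -> R of which only the
   values on (0, +oo) are constrained. *)

Section Definitions.
Context {R : realType}.
Implicit Types (B tau u v g f G phi : R -> R).
Implicit Type p : {finite_measure set (measurableTypeR R) -> \bar R}.

(* p has a density d on [0, delta[ (hence no atom at 0), and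
   d z = p0 z^(mu-1) + o(z^(mu-1)) as z -> 0. *)
Definition power_density_near0 p (p0 mu : R) : Prop :=
  exists (delta : R) (d : R -> R),
  [/\ 0 < delta,
      measurable_fun `[0, delta[ d,
      (forall z, 0 < z -> z < delta -> 0 <= d z),
      (forall A : set (measurableTypeR R), measurable A -> A `<=` `[0, delta[ ->
         p A = (\int[lebesgue_measure]_(z in A) (d z)%:E)%E)
    & (d : R -> R^o) = (fun z => p0 * z `^ (mu - 1))
                       +o_ (0^'+) (fun z : R => z `^ (mu - 1) : R^o)].

Record standing_setting B tau p
    (B0 Binf tau0 tauinf gamma0 gamma alpha0 alpha p0 mu : R) : Prop := {
  B_pos : forall x : R, 0 < x -> 0 < B x ;
  B_loc_integrable : locally_integrable `]0, +oo[ B ;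
  p_support : p (~` `[0, 1]) = 0%E ;
  p_mean : (\int[p]_(z in `[0%R, 1%R]) z%:E)%E = 1%E ;
  p_mass : (1 < p `[0%R, 1%R]%classic)%E ;
  tau_pos : forall x : R, 0 < x -> 0 < tau x ;
  tau_continuous : {within `]0, +oo[, continuous tau} ;
  B0_pos : 0 < B0 ;
  Binf_pos : 0 < Binf ;
  tau0_pos : 0 < tau0 ;
  tauinf_pos : 0 < tauinf ;
  B_at0 : (B : R -> R^o) ~_(0^'+) (fun x => B0 * x `^ gamma0) ;
  tau_at0 : (tau : R -> R^o) ~_(0^'+) (fun x => tau0 * x `^ alpha0) ;
  B_atinf : (B : R -> R^o) ~_(+oo_R) (fun x => Binf * x `^ gamma) ;
  tau_atinf :
    (tau : R -> R^o) ~_(+oo_R) (fun x => tauinf * x `^ alpha) ;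
  exponents_at0 : 0 < gamma0 - alpha0 + 1 ;
  exponents_atinf : 0 < gamma - alpha + 1 ;
  p0_ge0 : 0 <= p0 ;
  mu_pos : 0 < mu ;
  p_near0 : power_density_near0 p p0 mu ;
  exponent_mu : 0 < mu - alpha0 + 1 }.

(* Gain term int_x^oo b(y, x) g(y) dy with b(y, x) = B(y) / y * p(x / y), in
   the variable z = x / y; the point z = 0 contributes 0, as 0^-1 = 0. *)
Definition gain B p g (x : R) : R :=
  \int[p]_(z in `[0, 1]) (B (x / z) * g (x / z) / z).

(* \mathcal{L} g *)
Definition fragmentation B p g (x : R) : R := gain B p g x - B x * g x.

(* int_0^x b(x, y) f(y) dy *)
Definition dual_gain B p f (x : R) : R :=
  B x * \int[p]_(z in `[0, 1]) f (x * z).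

(* u' = v on (0, +oo): u is locally absolutely continuous there and v is its
   almost everywhere derivative, equivalently its derivative in the sense of
   distributions. *)
Definition has_weak_derivative u v : Prop :=
  locally_integrable `]0, +oo[ v /\
  forall a b : R, 0 < a -> a <= b ->
    u b - u a = \int[lebesgue_measure]_(x in `[a, b]) v x.

(* (lambda, G, phi) is the solution of the eigenproblem. The polynomial bound
   on phi belongs to the existence and uniqueness theorem defining the triple:
   without it there can be further triples, with phi unbounded at 0 (already
   for p twice the Dirac mass at 1/2), and the eigenproblem does not determine
   lambda. Rintegral being 0 on functions that are not integrable, the
   integrability of the integrands over p is part of the equations. *)
Record eigentriple B tau p (lambda : R) G phi : Prop := {
  lambda_pos : 0 < lambda ;
  G_ge0 : forall x : R, 0 < x -> 0 <= G x ;
  G_gain_integrable : {ae lebesgue_measure, forall x : R, 0 < x ->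
    p.-integrable `[0%R, 1%R] (fun z : R => (B (x / z) * G (x / z) / z)%:E)} ;
  G_equation : has_weak_derivative (fun x => tau x * G x)
    (fun x => fragmentation B p G x - lambda * G x) ;
  G_boundary : tau x * G x @[x --> 0^'+] --> 0 ;
  G_mass : (\int[lebesgue_measure]_(x in `]0%R, +oo[) (G x)%:E)%E = 1%E ;
  phi_ge0 : forall x : R, 0 < x -> 0 <= phi x ;
  phi_gain_integrable : forall x : R, 0 < x ->
    p.-integrable `[0%R, 1%R] (fun z : R => (phi (x * z))%:E) ;
  phi_equation : has_weak_derivative phi
    (fun x => ((B x + lambda) * phi x - dual_gain B p phi x) / tau x) ;
  phi_growth : exists K k : R, 0 <= k /\
    forall x : R, 0 < x -> phi x <= K * (1 + x `^ k) ;
  phi_mass :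
    (\int[lebesgue_measure]_(x in `]0%R, +oo[) (G x * phi x)%:E)%E = 1%E }.

Definition oriented_integral (a b : R) f : R :=
  if a <= b then \int[lebesgue_measure]_(y in `[a, b]) f y
  else - \int[lebesgue_measure]_(y in `[b, a]) f y.

Definition Lambda B tau (lambda x : R) : R :=
  oriented_integral 1 x (fun y => (lambda + B y) / tau y).

End Definitions.

(* Main.v *)
Require Import Defs.
From mathcomp Require Import all_boot all_order all_algebra.
From mathcomp Require Import all_classical all_reals all_analysis.
From mathcomp Require Import measurable_realfun ring lra.
Import Order.TTheory GRing.Theory Num.Theory.
Import numFieldNormedType.Exports.
Local Open Scope classical_set_scope.
Local Open Scope ring_scope.

(** Write q = (lambda + B) / tau and h(x) = (B(x) / tau(x)) int phi(xz) p(dz).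
    The adjoint equation reads phi' = q phi - h, and Lambda is a primitive of
    q, so psi := phi e^(-Lambda) satisfies psi' = - h e^(-Lambda) <= 0
    ([weak_derivative_integrating_factor]). Thus psi is nonincreasing and has
    a limit C at 0+. This limit is positive: otherwise psi, hence phi, would
    vanish identically, against int G phi = 1. All the work is to show that
    psi is bounded near 0.

    When alpha0 >= 1, e^Lambda tends to 0 at 0, and knowing that phi is bounded
    near 0 says little about psi. The bound is improved by a loop on the
    integrated equation ([bounded_by_integrating_factor]). Since
    gamma0 - alpha0 > -1, B / tau is integrable at 0, and there is x0 > 0 with
    m int_0^x0 B / tau <= 1/2, where m is the mass of p. Suppose that
    phi <= k + a e^Lambda on (0, x0]. The right-hand side is nondecreasing, so
    the nonlocal term obeys int phi(yz) p(dz) <= m (k + a e^(Lambda(y))), and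
    integrating psi' from x to x0 gives
      psi(x) <= psi(x0) + m int_x^x0 (B / tau) (k e^(-Lambda) + a)
             <= psi(x0) + (k e^(-Lambda(x)) + a) / 2,
    that is phi <= k / 2 + (psi(x0) + a / 2) e^Lambda. Starting from a bound
    phi <= K and iterating, phi <= K / 2^n + 2 psi(x0) e^Lambda for all n,
    whence psi <= 2 psi(x0). As p has no atom at 0, the value of phi at 0, which
    the equation leaves free, does not enter the nonlocal term.

    The coefficient B is merely locally integrable, so the equations hold in
    the integrated sense of [has_weak_derivative] and the product and chain
    rules have to be proved in that sense. Both follow from one remark: a
    function whose increments are bounded by the squares of the increments of
    a continuous nondecreasing function is constant
    ([quadratic_increments_constant]). *)

(** * Local integrability on the positive half-line *)

Section PositiveHalfLine.
Context {R : realType}.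
Local Notation leb := (@lebesgue_measure R).
Implicit Types (f g h u v : R -> R) (K : set R) (a b c s t x y : R).

Lemma segment_sub_positive {a b} : 0 < a -> `[a, b] `<=` `]0, +oo[.
Proof.
by move=> a0 x /=; rewrite !in_itv/= andbT => /andP[ax _]; exact: lt_le_trans ax.
Qed.

Lemma locally_integrable_compact {f K} : locally_integrable `]0, +oo[ f ->
  K `<=` `]0, +oo[ -> compact K -> leb.-integrable K (EFin \o f).
Proof.
move=> [mf _ foo] KD cK; apply/integrableP; split; last exact: foo.
by apply/measurable_EFinP; apply: measurable_funS mf.
Qed.

Lemma locally_integrable_segment {f a b} : locally_integrable `]0, +oo[ f ->
  0 < a -> leb.-integrable `[a, b] (EFin \o f).
Proof.
move=> lf a0; apply: (locally_integrable_compact lf).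
  exact: segment_sub_positive.
exact: segment_compact.
Qed.

Lemma locally_integrableM_continuous {f g} : locally_integrable `]0, +oo[ f ->
  {within `]0, +oo[, continuous g} -> locally_integrable `]0, +oo[ (f \* g).
Proof.
move=> lf cg; have mg : measurable_fun (`]0, +oo[ : set R) g.
  by apply: subspace_continuous_measurable_fun.
have [mf oD _] := lf; split => //; first exact: measurable_funM.
move=> K KD cK.
suff /integrableP[] : leb.-integrable K ((EFin \o f) \* (EFin \o g))%E by [].
apply: integrableMl.
- exact: compact_measurable.
- exact: locally_integrable_compact.
- by apply: measurable_funS mg.
- have : compact (g @` K).
    by apply: continuous_compact => //; exact: continuous_subspaceW cg.
  move=> /compact_bounded [M [Mr H]]; exists M; split => // N MN x Kx.
  by apply: (H N MN); exists x.
Qed.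

Lemma locally_integrableZl c {f} : locally_integrable `]0, +oo[ f ->
  locally_integrable `]0, +oo[ (fun x => c * f x).
Proof.
move=> lf; have := locally_integrableM_continuous (g := cst c) lf.
rewrite (_ : f \* cst c = fun x => c * f x); last first.
  by apply/funext => x /=; rewrite mulrC.
by apply; apply: continuous_subspaceT => ?; exact: cvg_cst.
Qed.

Lemma continuous_locally_integrable f :
  {within `]0, +oo[, continuous f} -> locally_integrable `]0, +oo[ f.
Proof.
move=> cf; split; first exact: subspace_continuous_measurable_fun.
  exact: interval_open.
move=> K KD cK.
suff /integrableP[] : leb.-integrable K (EFin \o f) by [].
exact/continuous_compact_integrable/(continuous_subspaceW KD).
Qed.

Lemma Rintegral_segmentN {f a b} : leb.-integrable `[a, b] (EFin \o f) ->
  \int[leb]_(x in `[a, b]) (- f x) = - \int[leb]_(x in `[a, b]) f x.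
Proof.
move=> intf; rewrite -mulN1r -RintegralZl//.
by apply: eq_Rintegral => x _; rewrite mulN1r.
Qed.

Lemma Rintegral_segmentD {f a b c} : leb.-integrable `[a, c] (EFin \o f) ->
  a <= b -> b <= c ->
  \int[leb]_(x in `[a, c]) f x =
  \int[leb]_(x in `[a, b]) f x + \int[leb]_(x in `[b, c]) f x.
Proof.
move=> intf ab bc; have := Rintegral_itvB intf.
move=> /(_ b); rewrite !bnd_simp => /(_ ab bc) /eqP; rewrite subr_eq => /eqP ->.
rewrite addrC Rintegral_itv_obnd_cbnd//.
by apply: integrableS intf => //; apply: subset_itv; rewrite bnd_simp.
Qed.

Lemma le_normr_Rintegral_segment {f g s t} : leb.-integrable `[s, t] (EFin \o f) ->
  leb.-integrable `[s, t] (EFin \o g) ->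
  (forall x, s <= x -> x <= t -> `|f x| <= g x) ->
  `|\int[leb]_(x in `[s, t]) f x| <= \int[leb]_(x in `[s, t]) g x.
Proof.
move=> intf intg fg; apply: le_trans (le_normr_Rintegral _ intf) _ => //.
apply: le_Rintegral => //; first exact: (integrable_norm intf).
by move=> x /=; rewrite in_itv/= => /andP[sx xt]; exact: fg.
Qed.

Lemma le_Rintegral_subsegment {f a b s t} : leb.-integrable `[a, b] (EFin \o f) ->
  (forall x, a <= x -> x <= b -> 0 <= f x) -> a <= s -> s <= t -> t <= b ->
  \int[leb]_(x in `[s, t]) f x <= \int[leb]_(x in `[a, b]) f x.
Proof.
move=> intf f0 as_ st tb.
have at_ := le_trans as_ st; have sb := le_trans st tb.
have intat : leb.-integrable `[a, t] (EFin \o f).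
  by apply: integrableS intf => //; apply: subset_itv; rewrite bnd_simp.
rewrite (Rintegral_segmentD intf at_ tb) (Rintegral_segmentD intat as_ st).
rewrite addrAC lerDr addr_ge0//; apply: Rintegral_ge0 => x /=; rewrite in_itv/=.
  by move=> /andP[? ?]; apply: f0 => //; lra.
by move=> /andP[? ?]; apply: f0 => //; lra.
Qed.

(** * Calculus of weak derivatives *)

Lemma within_segments_continuous u :
  (forall a b, 0 < a -> a <= b -> {within `[a, b], continuous u}) ->
  {within `]0, +oo[, continuous u}.
Proof.
move=> cu; rewrite continuous_open_subspace; last exact: interval_open.
move=> x; rewrite inE/= in_itv/= andbT => x0.
have := cu (x / 2) (x * 2).
rewrite divr_gt0// ler_pdivrMr// -mulrA ler_peMr//; last 2 first.
- exact: ltW.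
- by rewrite -natrM ler1n.
move=> /(_ erefl erefl) /(continuous_subspaceW (@subset_itv_oo_cc _ _ _ _)).
rewrite continuous_open_subspace; last exact: interval_open.
apply; rewrite inE/= in_itv/=; apply/andP; split; lra.
Qed.

Lemma weak_derivative_continuous {u u'} : has_weak_derivative u u' ->
  {within `]0, +oo[, continuous u}.
Proof.
move=> [lu' uE]; apply: within_segments_continuous => a b a0 ab.
have lab := locally_integrable_segment (b := b) lu' a0.
have H := parameterized_integral_continuous ab lab.
have : {within `[a, b], continuous
    (fun x => u a + parameterized_integral leb a x u')}.
  move=> x; apply: cvgD; [exact: cvg_cst|exact: H].
apply: subspace_eq_continuous => x; rewrite inE/= in_itv/= => /andP[ax xb].
rewrite /from_subspace/=.
rewrite -[parameterized_integral _ _ _ _]/(\int[leb]_(t in `[a, x]) u' t).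
by rewrite -uE// addrC subrK.
Qed.

Lemma weak_derivative_ge0_nondecreasing {u u'} : has_weak_derivative u u' ->
  (forall x, 0 < x -> 0 <= u' x) -> forall x y, 0 < x -> x <= y -> u x <= u y.
Proof.
move=> [_ uE] u'0 x y x0 xy; rewrite -subr_ge0 uE//; apply: Rintegral_ge0 => z /=.
by rewrite in_itv/= => /andP[xz _]; apply: u'0; exact: lt_le_trans xz.
Qed.

Lemma weak_derivativeN {u u'} : has_weak_derivative u u' ->
  has_weak_derivative (fun x => - u x) (fun x => - u' x).
Proof.
move=> [lu' uE]; split => [|a b a0 ab]; first exact: locally_integrableN.
rewrite Rintegral_segmentN; last exact: locally_integrable_segment.
by rewrite -uE// opprB opprK addrC.
Qed.

Lemma ler_half_powers {x y C} : (forall n : nat, x <= C / 2 ^+ n + y) -> x <= y.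
Proof.
move=> H; rewrite leNgt; apply/negP => yx.
have xy0 : 0 < x - y by rewrite subr_gt0.
have := H (Num.truncn (C / (x - y))).+1; set n := _.+1.
rewrite leNgt => /negP; apply; rewrite -ltrBrDr ltr_pdivrMr ?exprn_gt0//.
rewrite mulrC -ltr_pdivrMr//; apply: lt_trans (truncnS_gt _) _.
by rewrite -natrX ltr_nat ltn_expl.
Qed.

(** Cutting [s, t] at the point where Q takes the mean of its end values
    divides the bound on the increment of F by two: each half contributes a
    quarter. Hence every C can be replaced by C / 2^n. *)
Lemma quadratic_increments_constant {F Q : R -> R} {a b C} : a <= b ->
  {within `[a, b], continuous Q} ->
  (forall s t, a <= s -> s <= t -> t <= b -> Q s <= Q t) ->
  (forall s t, a <= s -> s <= t -> t <= b ->
     `|F t - F s| <= C * (Q t - Q s) ^+ 2) ->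
  F a = F b.
Proof.
move=> ab cQ ndQ HF.
have HFn n : forall s t, a <= s -> s <= t -> t <= b ->
    `|F t - F s| <= C / 2 ^+ n * (Q t - Q s) ^+ 2.
  elim: n => [|n IH] s t as_ st tb; first by rewrite expr0 divr1; exact: HF.
  have cQst : {within `[s, t], continuous Q}.
    by apply: continuous_subspaceW cQ; apply: subset_itv; rewrite bnd_simp.
  have Qst := ndQ _ _ as_ st tb.
  have [|c] := @IVT _ Q s t ((Q s + Q t) / 2) st cQst.
    by rewrite min_l// max_r//; apply/andP; split; lra.
  rewrite in_itv/= => /andP[sc ct] Qc.
  have -> : F t - F s = (F t - F c) + (F c - F s) by ring.
  apply: le_trans (ler_normD _ _) _.
  apply: le_trans (lerD (IH c t _ ct tb) (IH s c as_ sc _)) _.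
  - exact: le_trans sc.
  - exact: le_trans tb.
  rewrite Qc (exprS 2 n) invfM.
  rewrite le_eqVlt; apply/orP; left; apply/eqP; field.
  by rewrite expf_neq0// pnatr_eq0.
apply/eqP; rewrite eq_sym -subr_eq0 -normr_le0.
apply: (@ler_half_powers _ _ (C * (Q b - Q a) ^+ 2)) => n.
by rewrite addr0 mulrAC; exact: HFn.
Qed.

(** An antiderivative may be identified up to errors of second order with
    respect to a measure g dx, where g is allowed to depend on the functions at
    hand: the defect u - int w then has quadratic increments. *)
Lemma weak_derivative_criterion {u w g} : locally_integrable `]0, +oo[ w ->
  locally_integrable `]0, +oo[ g -> (forall x, 0 < x -> 0 <= g x) ->
  (forall a b, 0 < a -> a <= b -> exists C, forall s t,
     a <= s -> s <= t -> t <= b ->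
     `|u t - u s - \int[leb]_(x in `[s, t]) w x|
       <= C * (\int[leb]_(x in `[s, t]) g x) ^+ 2) ->
  has_weak_derivative u w.
Proof.
move=> lw lg g0 H; split => // a b a0 ab; have [C HC] := H a b a0 ab.
have splitD f s t : locally_integrable `]0, +oo[ f -> a <= s -> s <= t ->
    \int[leb]_(x in `[a, t]) f x - \int[leb]_(x in `[a, s]) f x =
    \int[leb]_(x in `[s, t]) f x.
  move=> lf as_ st.
  rewrite (Rintegral_segmentD (locally_integrable_segment lf a0) as_ st).
  by rewrite addrAC subrr add0r.
pose Q x := \int[leb]_(y in `[a, x]) g y.
pose F x := u x - \int[leb]_(y in `[a, x]) w y.
have : F a = F b.
  apply: (@quadratic_increments_constant F Q a b C) => //.
  - exact: (parameterized_integral_continuous ab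
      (locally_integrable_segment lg a0)).
  - move=> s t as_ st tb; rewrite -subr_ge0 splitD//.
    apply: Rintegral_ge0 => x /=; rewrite in_itv/= => /andP[sx _].
    by apply: g0; apply: lt_le_trans sx; exact: lt_le_trans as_.
  - move=> s t as_ st tb; rewrite splitD//.
    have -> : F t - F s = u t - u s - \int[leb]_(x in `[s, t]) w x.
      by rewrite -(splitD w s t)// /F; ring.
    exact: HC.
rewrite /F set_itv1 Rintegral_set1 subr0 => ->.
by rewrite opprB addrCA subrr addr0.
Qed.

(** The product rule up to a second-order error: the increment of u v over
    [s, t] is the integral of v(t) u' + u(s) v', and replacing v(t) and u(s) by
    v(x) and u(x) costs at most (int (|u'| + |v'|))^2. *)
Lemma weak_derivativeM {u u' v v'} :
  has_weak_derivative u u' -> has_weak_derivative v v' ->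
  has_weak_derivative (u \* v) (u' \* v \+ v' \* u).
Proof.
move=> hu hv; have [lu' uE] := hu; have [lv' vE] := hv.
have cu := weak_derivative_continuous hu; have cv := weak_derivative_continuous hv.
have lw : locally_integrable `]0, +oo[ (u' \* v \+ v' \* u).
  by apply: locally_integrableD; exact: locally_integrableM_continuous.
have ln f : locally_integrable `]0, +oo[ f ->
    locally_integrable `]0, +oo[ (fun x => `|f x|).
  move=> [mf oD foo]; split => //; first exact: measurableT_comp.
  by move=> K KD cK; under eq_integral do rewrite normr_id; exact: foo.
pose g x := `|u' x| + `|v' x|.
have lg : locally_integrable `]0, +oo[ g.
  by apply: locally_integrableD; exact: ln.
apply: (weak_derivative_criterion lw lg); first by move=> x _; rewrite addr_ge0.
move=> a b a0 ab; exists 1 => s t as_ st tb; rewrite mul1r.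
have s0 : 0 < s by exact: lt_le_trans as_.
set D := \int[leb]_(x in `[s, t]) g x.
have int f : locally_integrable `]0, +oo[ f -> leb.-integrable `[s, t] (EFin \o f).
  by move=> lf; exact: locally_integrable_segment.
have varD f f' x y : has_weak_derivative f f' -> (forall z, `|f' z| <= g z) ->
    s <= x -> x <= y -> y <= t -> `|f y - f x| <= D.
  move=> [lf' fE] f'g sx xy yt.
  have x0 : 0 < x by exact: lt_le_trans sx.
  rewrite fE//; apply: le_trans (le_Rintegral_subsegment (int g lg) _ sx xy yt).
    apply: le_normr_Rintegral_segment => //; exact: locally_integrable_segment.
  by move=> z _ _; rewrite addr_ge0.
have u'g z : `|u' z| <= g z by rewrite lerDl.
have v'g z : `|v' z| <= g z by rewrite lerDr.
have ll : locally_integrable `]0, +oo[ (fun x => v t * u' x + u s * v' x).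
  by apply: locally_integrableD; exact: locally_integrableZl.
have -> : (u \* v) t - (u \* v) s
      - \int[leb]_(x in `[s, t]) (u' \* v \+ v' \* u) x =
    - \int[leb]_(x in `[s, t])
        ((u' \* v \+ v' \* u) x - (v t * u' x + u s * v' x)).
  rewrite RintegralB//; [|exact: int|exact: int].
  rewrite [X in - (_ - X)]RintegralD//;
    [|exact/int/locally_integrableZl|exact/int/locally_integrableZl].
  by rewrite !RintegralZl -?uE -?vE//=; [ring|exact: int|exact: int].
have intw : leb.-integrable `[s, t]
    (EFin \o (fun x => (u' \* v \+ v' \* u) x - (v t * u' x + u s * v' x))).
  exact/int/(locally_integrableB lw ll).
rewrite normrN.
have intDg := int _ (locally_integrableZl D lg).
apply: le_trans (le_normr_Rintegral_segment intw intDg _) _; last first.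
  by rewrite RintegralZl//; exact: int.
move=> x sx xt.
have -> : (u' \* v \+ v' \* u) x - (v t * u' x + u s * v' x) =
    - (u' x * (v t - v x)) + v' x * (u x - u s) by move=> /=; ring.
apply: le_trans (ler_normD _ _) _; rewrite normrN !normrM /g mulrDr.
rewrite ![D * _]mulrC lerD// ler_wpM2l//.
- exact: (varD v v').
- exact: (varD u u').
Qed.

(** With d = L(t) - L(s), monotonicity places int q e^(-L) between e^(-L(t)) d
    and e^(-L(s)) d, and the increment of e^(-L) equals
    e^(-L(s)) (e^(-d) - 1): up to O(d^2), the first is e^(-L(s)) d and the
    second its opposite. *)
Lemma weak_derivative_expN {L q : R -> R} : has_weak_derivative L q ->
  (forall x, 0 < x -> 0 <= q x) ->
  has_weak_derivative (fun x => expR (- L x)) (fun x => - (q x * expR (- L x))).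
Proof.
move=> hL q0; have [lq LE] := hL; set E := fun x => expR (- L x).
have cE : {within `]0, +oo[, continuous E}.
  move=> x; apply: continuous_comp; last exact: continuous_expR.
  by apply: cvgN; exact: (weak_derivative_continuous hL).
have lqE := locally_integrableM_continuous lq cE.
apply: (weak_derivative_criterion (locally_integrableN lqE) lq q0).
move=> a b a0 ab; exists (E a) => s t as_ st tb.
have s0 : 0 < s by exact: lt_le_trans as_.
have int f : locally_integrable `]0, +oo[ f -> leb.-integrable `[s, t] (EFin \o f).
  by move=> lf; exact: locally_integrable_segment.
have intZ c : leb.-integrable `[s, t] (EFin \o (fun x => c * q x)).
  exact/int/locally_integrableZl.
have Lnd := weak_derivative_ge0_nondecreasing hL q0.
have Eni x y : 0 < x -> x <= y -> E y <= E x.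
  by move=> x0 xy; rewrite ler_expR lerN2; exact: Lnd.
rewrite -LE//; set d := L t - L s.
have d0 : 0 <= d by rewrite subr_ge0 Lnd.
rewrite (Rintegral_segmentN (int _ lqE)).
set I := \int[leb]_(x in `[s, t]) (q x * E x).
have IE : E t * d <= I <= E s * d.
  rewrite /d LE// -!RintegralZl//; [|exact: int|exact: int].
  apply/andP; split; apply: le_Rintegral => //; try exact: int.
  - move=> x /=; rewrite in_itv/= => /andP[sx xt]; rewrite mulrC ler_wpM2l//.
      by apply: q0; exact: lt_le_trans sx.
    by apply: Eni => //; exact: lt_le_trans sx.
  - move=> x /=; rewrite in_itv/= => /andP[sx xt]; rewrite mulrC ler_wpM2r//.
      by apply: q0; exact: lt_le_trans sx.
    exact: Eni.
have EtE : E t = E s * expR (- d).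
  by rewrite /E -expRD; congr expR; rewrite /d; ring.
have Es0 : 0 < E s by exact: expR_gt0.
have lo : 1 - d <= expR (- d) by exact: expR_ge1Dx.
(* From the other side, exp (-d) <= 1 / (1 + d) <= 1 - d + d ^ 2. *)
have hi : expR (- d) <= 1 - d + d ^+ 2.
  rewrite expRN; apply: (@le_trans _ _ (1 + d)^-1).
    by rewrite lef_pV2 ?posrE ?expR_gt0// ?expR_ge1Dx//; lra.
  rewrite -div1r ler_pdivrMr; last by lra.
  have := exprn_ge0 3 d0; lra.
apply: (@le_trans _ _ (E s * d ^+ 2)); last by rewrite ler_wpM2r ?sqr_ge0// Eni.
move: IE => /andP[I1 I2]; rewrite EtE in I1 *.
have lo1 := ler_wpM2l (ltW Es0) lo.
have lo2 := ler_wpM2l (mulr_ge0 (ltW Es0) d0) lo.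
have hi1 := ler_wpM2l (ltW Es0) hi.
by rewrite ler_norml; apply/andP; split; lra.
Qed.

Lemma weak_derivative_integrating_factor {u q h L : R -> R} :
  (forall x, 0 < x -> 0 <= q x) -> has_weak_derivative L q ->
  has_weak_derivative u (fun x => q x * u x - h x) ->
  has_weak_derivative (fun x => u x * expR (- L x))
    (fun x => - (h x * expR (- L x))).
Proof.
move=> q0 hL hu; have := weak_derivativeM hu (weak_derivative_expN hL q0).
congr has_weak_derivative; apply/funext => x /=; ring.
Qed.

Lemma oriented_integral_weak_derivative {c} {f : R -> R} : 0 < c ->
  locally_integrable `]0, +oo[ f ->
  has_weak_derivative (fun x => oriented_integral c x f) f.
Proof.
move=> c0 lf; split => // a b a0 ab.
have int s t : 0 < s -> leb.-integrable `[s, t] (EFin \o f).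
  exact: locally_integrable_segment.
rewrite /oriented_integral.
have [ca|ac] := leP c a; have [cb|bc] := leP c b.
- by rewrite (Rintegral_segmentD (int c b c0) ca ab); ring.
- by move: (lt_le_trans bc (le_trans ca ab)); rewrite ltxx.
- by rewrite (Rintegral_segmentD (int a b a0) (ltW ac) cb); ring.
- by rewrite (Rintegral_segmentD (int a c a0) ab (ltW bc)); ring.
Qed.

(** * Power-like behaviour near zero *)

Lemma near_at_right0 {P : R -> Prop} : (\forall x \near 0^'+, P x) ->
  exists2 e, 0 < e & forall x, 0 < x -> x < e -> P x.
Proof.
move=> [e /= e0 He]; exists e => // x x0 xe; apply: He => //=.
by rewrite sub0r normrN gtr0_norm.
Qed.

Lemma equiv_pos_bounds {f g : R -> R} :
  (f : R -> R^o) ~_(0^'+) g -> (forall x, 0 < x -> 0 < g x) ->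
  \forall x \near 0^'+, g x / 2 <= f x <= 2 * g x.
Proof.
move=> /eqaddoP fg g0.
have h0 : 0 < 2^-1 :> R by rewrite invr_gt0.
have {}fg := fg _ h0.
near=> x; have x0 : 0 < x by [].
have : `|f x - g x| <= 2^-1 * `|g x| by near: x.
rewrite (gtr0_norm (g0 x x0)) ler_norml => /andP[? ?].
have := g0 _ x0; lra.
Unshelve. all: by end_near. Qed.

Lemma equiv_powR_ratio_bound {f g a b r s} : 0 < a -> 0 < b ->
  (f : R -> R^o) ~_(0^'+) (fun x => a * x `^ r) ->
  (g : R -> R^o) ~_(0^'+) (fun x => b * x `^ s) ->
  \forall x \near 0^'+, f x / g x <= 4 * a / b * x `^ (r - s).
Proof.
move=> a0 b0 fE gE.
have fb := equiv_pos_bounds fE (fun x xpos => mulr_gt0 a0 (powR_gt0 r xpos)).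
have gb := equiv_pos_bounds gE (fun x xpos => mulr_gt0 b0 (powR_gt0 s xpos)).
near=> x; have x0 : 0 < x by [].
have /andP[fx fx2] : a * x `^ r / 2 <= f x <= 2 * (a * x `^ r) by near: x.
have /andP[gx _] : b * x `^ s / 2 <= g x <= 2 * (b * x `^ s) by near: x.
have f0 : 0 < f x by apply: lt_le_trans fx; rewrite divr_gt0// mulr_gt0// powR_gt0.
have bx0 : 0 < b * x `^ s / 2 by rewrite divr_gt0// mulr_gt0// powR_gt0.
have g0 : 0 < g x by exact: lt_le_trans gx.
rewrite powRB; last by apply/implyP => _; rewrite gt_eqF.
have -> : 4 * a / b * (x `^ r / x `^ s) = 2 * (a * x `^ r) / (b * x `^ s / 2).
  by field; rewrite !gt_eqF ?powR_gt0.
apply: ler_pM => //; rewrite ?invr_ge0 ?(ltW f0) ?(ltW g0)//.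
by rewrite lef_pV2 ?posrE.
Unshelve. all: by end_near. Qed.

Lemma Rintegral_powR_le {s a b} : 0 < s + 1 -> 0 < a -> a <= b ->
  \int[leb]_(x in `[a, b]) x `^ s <= b `^ (s + 1) / (s + 1).
Proof.
move=> s1 a0; rewrite le_eqVlt => /predU1P[<-|ab].
  by rewrite set_itv1 Rintegral_set1 divr_ge0 ?powR_ge0// ltW.
pose F x := x `^ (s + 1) / (s + 1).
have dF x : 0 < x -> is_derive x 1 F (x `^ s).
  move=> x0; have H := @is_derive1_powR R (s + 1) x x0.
  have := is_deriveM H (is_derive_cst ((s + 1)^-1) x 1).
  rewrite scaler0 add0r => K; apply: is_derive_eq K _ => /=.
  by rewrite addrK /GRing.scale/= mulrA mulVf ?mul1r// gt_eqF.
have cf x r : 0 < x -> {for x, continuous (fun x => x `^ r)}.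
  move=> x0; apply: differentiable_continuous.
  by apply/derivable1_diffP; apply: derivable_powR; rewrite in_itv/= x0.
have cF x : 0 < x -> {for x, continuous F}.
  move=> x0; apply: differentiable_continuous.
  by apply/derivable1_diffP; have [] := dF x x0.
have b0 := lt_trans a0 ab.
rewrite /Rintegral (@continuous_FTC2 _ _ F)//.
- by rewrite -EFinB/= /F gerBl// divr_ge0 ?powR_ge0// ltW.
- apply: continuous_in_subspaceT => x; rewrite inE/= in_itv/= => /andP[ax _].
  by apply: cf; exact: lt_le_trans ax.
- split.
  + move=> x; rewrite in_itv/= => /andP[ax _].
    by have [] := dF x (lt_trans a0 ax).
  + by apply: cvg_at_right_filter; exact: cF.
  + by apply: cvg_at_left_filter; exact: cF.
- move=> x; rewrite in_itv/= => /andP[ax _].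
  rewrite derive1E.
  by have [] := dF x (lt_trans a0 ax).
Qed.

Lemma Rintegral_power_bound_small {f : R -> R} {c s eps} : 0 < s + 1 -> 0 < eps ->
  locally_integrable `]0, +oo[ f ->
  (\forall x \near 0^'+, f x <= c * x `^ s) ->
  \forall y \near 0^'+, forall x, 0 < x -> x <= y ->
    \int[leb]_(t in `[x, y]) f t <= eps.
Proof.
move=> s1 eps0 lf /near_at_right0 [e e0 fe].
(* The constant |c| + 1 replaces c so as to be positive. *)
have c0 : 0 < `|c| + 1 by rewrite ltr_wpDl.
near=> y => x x0 xy.
have ye : y < e by near: y; exact: nbhs_right_lt.
have intp : leb.-integrable `[x, y] (EFin \o (fun t => t `^ s)).
  apply: (locally_integrable_segment _ x0).
  apply: continuous_locally_integrable; apply: continuous_in_subspaceT => z.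
  rewrite inE/= in_itv/= andbT => z0; apply: differentiable_continuous.
  by apply/derivable1_diffP; apply: derivable_powR; rewrite in_itv/= z0.
apply: (@le_trans _ _ (\int[leb]_(t in `[x, y]) ((`|c| + 1) * t `^ s))).
  apply: le_Rintegral => //.
  - exact: locally_integrable_segment.
  - exact: (integrableZl _ _ intp).
  move=> t /=; rewrite in_itv/= => /andP[xt ty].
  apply: le_trans (fe _ (lt_le_trans x0 xt) (le_lt_trans ty ye)) _.
  by rewrite ler_wpM2r ?powR_ge0// (le_trans (ler_norm _))// lerDl.
rewrite RintegralZl//.
apply: le_trans (ler_wpM2l (ltW c0) (Rintegral_powR_le s1 x0 xy)) _.
rewrite mulrCA -ler_pdivlMr; last by rewrite divr_gt0.
apply: ltW; near: y; apply: (cvgr_lt _ (powR_cvg0 s1)).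
by rewrite !divr_gt0.
Unshelve. all: by end_near. Qed.

(** * Averages of dilations *)

Implicit Types p : {finite_measure set (measurableTypeR R) -> \bar R}.

Lemma no_atom_at0 {p} {p0 mu : R} : power_density_near0 p p0 mu -> p [set 0] = 0%E.
Proof.
move=> [delta [d [delta0 _ _ pd _]]].
by rewrite pd ?integral_set1// => x ->; rewrite /= in_itv/= lexx.
Qed.

Lemma integrable_unit_subset {p f} (A : set R) :
  measurable (A : set (measurableTypeR R)) -> A `<=` `[0%R, 1%R] ->
  p.-integrable `[0%R, 1%R] (EFin \o f) -> p.-integrable A (EFin \o f).
Proof.
move=> mA A01 intf.
have m01 : measurable (`[0%R, 1%R]%classic : set (measurableTypeR R)).
  exact: measurable_itv.
exact: (integrableS m01 mA A01 intf).
Qed.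

(** The functions to be averaged are controlled on (0, +oo) only, so z = 0 has
    to be removed before any bound on them can be used. *)
Lemma Rintegral_unit_no_atom {p f} : p [set 0] = 0%E ->
  p.-integrable `[0%R, 1%R] (EFin \o f) ->
  \int[p]_(z in `[0, 1]) f z = \int[p]_(z in `]0, 1]) f z.
Proof.
move=> p00 intf.
have E : `[0, 1]%classic = [set (0 : R)] `|` `]0, 1]%classic.
  by rewrite setU1itv// bnd_simp.
rewrite E Rintegral_setU//=; last 2 first.
- by rewrite -E.
- by apply/disj_setPS => x [/= ->]; rewrite in_itv/= ltxx.
rewrite {1}/Rintegral null_set_integral ?add0r//.
have : p.-integrable [set (0 : R)] (EFin \o f).
  apply: integrable_unit_subset intf; first exact: measurable_set1.
  by move=> x ->; rewrite /= in_itv/= lexx ler01.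
by case/integrableP.
Qed.

Lemma Rintegral_dilation_ge0 {p f x} : p [set 0] = 0%E ->
  p.-integrable `[0%R, 1%R] (fun z : R => (f (x * z))%:E) -> 0 < x ->
  (forall y, 0 < y -> 0 <= f y) -> 0 <= \int[p]_(z in `[0, 1]) f (x * z).
Proof.
move=> p00 intf x0 f0; rewrite (Rintegral_unit_no_atom p00 intf).
apply: Rintegral_ge0 => z /=; rewrite in_itv/= => /andP[z0 _].
by apply: f0; rewrite mulr_gt0.
Qed.

Lemma Rintegral_dilation_le {p f x M} : p [set 0] = 0%E ->
  p.-integrable `[0%R, 1%R] (fun z : R => (f (x * z))%:E) -> 0 < x ->
  (forall y, 0 < y -> y <= x -> f y <= M) ->
  \int[p]_(z in `[0, 1]) f (x * z) <= M * fine (p `]0, 1]%classic).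
Proof.
move=> p00 intf x0 fM; rewrite (Rintegral_unit_no_atom p00 intf).
have m01 : measurable (`]0%R, 1%R]%classic : set (measurableTypeR R)).
  exact: measurable_itv.
rewrite -Rintegral_cst//; apply: le_Rintegral => //.
- by apply: integrable_unit_subset intf => //; exact: subset_itv_oc_cc.
- exact: finite_measure_integrable_cst.
- move=> z /=; rewrite in_itv/= => /andP[z0 z1].
  by apply: fM; rewrite ?mulr_gt0// ler_piMr// ltW.
Qed.

(** * Boundedness and limit of the rescaled solution *)

(** The bound that one pass of the equation improves has the form
    k + a e^L. A pass halves k and sends a to psi(x0) + a / 2, where
    psi = phi e^(-L); the value a = 2 psi(x0) is fixed, so that only the term
    K / 2^n changes along the iteration. Halving k relies on e^(-L) being
    nonincreasing: the integral of beta e^(-L) over [x, x0] is at most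
    e^(-L(x)) / 2, and the return from psi to phi cancels this exponential. *)
Lemma bounded_by_integrating_factor {phi h beta L : R -> R} {x0 K : R} :
  0 < x0 -> (forall x, 0 < x -> 0 <= phi x) ->
  (forall x, 0 < x -> x <= x0 -> phi x <= K) ->
  locally_integrable `]0, +oo[ beta -> (forall x, 0 < x -> 0 <= beta x) ->
  (forall x y, 0 < x -> x <= y -> L x <= L y) ->
  has_weak_derivative (fun x => phi x * expR (- L x))
    (fun x => - (h x * expR (- L x))) ->
  (forall x k a, 0 < x -> x <= x0 -> 0 <= k -> 0 <= a ->
    (forall y, 0 < y -> y <= x0 -> phi y <= k + a * expR (L y)) ->
    h x <= beta x * (k + a * expR (L x))) ->
  (forall x, 0 < x -> x <= x0 -> \int[leb]_(t in `[x, x0]) beta t <= 2^-1) ->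
  forall x, 0 < x -> x <= x0 ->
    phi x * expR (- L x) <= 2 * (phi x0 * expR (- L x0)).
Proof.
move=> x00 phi0 phiK lbeta beta0 Lnd psi' hle beta_small x x_gt0 xx0.
set A := phi x0 * expR (- L x0).
have A0 : 0 <= A by rewrite mulr_ge0 ?expR_ge0 ?phi0.
have K0 : 0 <= K by apply: le_trans (phiK _ x00 (lexx _)); exact: phi0.
suff H n : forall y, 0 < y -> y <= x0 ->
    phi y <= K / 2 ^+ n + 2 * A * expR (L y).
  rewrite expRN ler_pdivrMr ?expR_gt0//.
  by apply: ler_half_powers => n; exact: H.
elim: n => [|n IH] y y0 yx0.
  by rewrite expr0 divr1 ler_wpDr ?phiK// mulr_ge0 ?expR_ge0// mulr_ge0.
set k := K / 2 ^+ n in IH.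
have k0 : 0 <= k by rewrite divr_ge0// exprn_ge0.
have [lhE psiE] := psi'.
set E := expR (- L y).
have lhE' : locally_integrable `]0, +oo[ (fun x => h x * expR (- L x)).
  by have := locally_integrableN lhE; congr locally_integrable;
     apply/funext => z /=; rewrite opprK.
have inth := locally_integrable_segment (b := x0) lhE' y0.
have intb := locally_integrable_segment (b := x0) lbeta y0.
have intbk := locally_integrable_segment (b := x0)
  (locally_integrableZl (k * E + 2 * A) lbeta) y0.
have kEA0 : 0 <= k * E + 2 * A by rewrite addr_ge0// mulr_ge0// expR_ge0.
have le1 : \int[leb]_(t in `[y, x0]) (h t * expR (- L t)) <=
    (k * E + 2 * A) * 2^-1.
  apply: (@le_trans _ _ (\int[leb]_(t in `[y, x0]) ((k * E + 2 * A) * beta t))).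
    apply: le_Rintegral => // t /=; rewrite in_itv/= => /andP[yt tx0].
    have t0 : 0 < t by exact: lt_le_trans yt.
    have := hle _ _ _ t0 tx0 k0 (mulr_ge0 (ler0n _ 2) A0) IH.
    move=> /(ler_wpM2r (expR_ge0 (- L t))) /le_trans; apply.
    rewrite -mulrA mulrC ler_wpM2r ?beta0//.
    rewrite mulrDl -(mulrA (2 * A)) -expRD subrr expR0 mulr1.
    by rewrite lerD2r ler_wpM2l// ler_expR lerN2 Lnd.
  by rewrite RintegralZl// ler_wpM2l// beta_small.
have psiy : phi y * E = A + \int[leb]_(t in `[y, x0]) (h t * expR (- L t)).
  have := psiE _ _ y0 yx0; rewrite -/A -/E.
  by rewrite (Rintegral_segmentN inth) => H; lra.
have : phi y * E <= 2 * A + k / 2 * E by rewrite psiy; lra.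
have EL : E * expR (L y) = 1 by rewrite /E -expRD addNr expR0.
move=> /(ler_wpM2r (expR_ge0 (L y))).
rewrite mulrDl -!mulrA EL !mulr1 => /le_trans; apply.
rewrite exprS invfM mulrCA addrC /k.
by rewrite [_ * (2^-1 * _)]mulrCA [2^-1 * _]mulrC mulrA.
Qed.

(** A monotone psi = phi e^(-L) that is bounded on (0, x0] tends to its
    supremum C there, and C is positive as soon as phi is positive at some
    point x1, even beyond x0, since psi(min x0 x1) >= psi(x1). *)
Lemma nonincreasing_equiv_at0 {phi L : R -> R} {M x0 x1 : R} : 0 < x0 ->
  (forall x y, 0 < x -> x <= y ->
    phi y * expR (- L y) <= phi x * expR (- L x)) ->
  (forall x, 0 < x -> x <= x0 -> phi x * expR (- L x) <= M) ->
  0 < x1 -> 0 < phi x1 ->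
  exists C : R, 0 < C /\ (phi : R -> R^o) ~_(0^'+) (fun x => C * expR (L x)).
Proof.
move=> x00 psi_ni psiM x10 phix1.
pose psi x := phi x * expR (- L x).
pose C := sup (psi @` `]0, x0]).
have ub : has_ubound (psi @` `]0, x0]).
  exists M => _ [x xI <-]; move: xI; rewrite /= in_itv/= => /andP[? ?].
  exact: psiM.
have psiC : psi x @[x --> 0^'+] --> C.
  apply: nonincreasing_at_right_cvgr => //.
  by move=> x y /=; rewrite in_itv/= => /andP[? _] _ xy; exact: psi_ni.
have C0 : 0 < C.
  have lt0 : 0 < psi (Num.min x0 x1).
    apply: (@lt_le_trans _ _ (psi x1)); first by rewrite mulr_gt0 ?expR_gt0.
    by apply: psi_ni; rewrite ?lt_min ?x00// ge_min lexx orbT.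
  apply: lt_le_trans lt0 _; apply: ub_le_sup => //; exists (Num.min x0 x1) => //=.
  by rewrite in_itv/= lt_min x00 x10/= ge_min lexx.
exists C; split => //; apply/eqaddoP => eps eps0.
have nearC : \forall x \near 0^'+, `|C - psi x| <= eps * C.
  by move/cvgrPdist_le : psiC; apply; rewrite mulr_gt0.
apply: filterS nearC => x psix.
have -> : (phi - (fun x => C * expR (L x))) x = (psi x - C) * expR (L x).
  by rewrite /psi mulrBl -mulrA -expRD addNr expR0 mulr1.
by rewrite !normrM mulrA ler_wpM2r// (gtr0_norm C0) distrC.
Qed.

End PositiveHalfLine.

Theorem theorem1p10 (R : realType) (B tau : R -> R)
    (p : {finite_measure set (measurableTypeR R) -> \bar R})
    (B0 Binf tau0 tauinf gamma0 gamma alpha0 alpha p0 mu : R)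
    (lambda : R) (G phi : R -> R)
    (hset : standing_setting B tau p
              B0 Binf tau0 tauinf gamma0 gamma alpha0 alpha p0 mu)
    (hsol : eigentriple B tau p lambda G phi) :
  exists C : R, 0 < C /\
    (phi : R -> R^o) ~_(0^'+) (fun x => C * expR (Lambda B tau lambda x)).
Proof.
pose q x := (lambda + B x) / tau x.
pose L := Lambda B tau lambda.
pose h x := dual_gain B p phi x / tau x.
pose m := fine (p `]0, 1]%classic).
pose beta x := m * (B x / tau x).
have Bpos := B_pos hset; have taupos := tau_pos hset.
have phi0 := phi_ge0 hsol; have lam0 := lambda_pos hsol.
have p00 := no_atom_at0 (p_near0 hset).
have m0 : 0 <= m by apply: fine_ge0.
have Btau0 x : 0 < x -> 0 <= B x / tau x.
  by move=> x0; rewrite divr_ge0 ?ltW ?Bpos ?taupos.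
have ctauV : {within `]0, +oo[, continuous (fun x => (tau x)^-1)}.
  have := tau_continuous hset.
  rewrite !continuous_open_subspace; [|exact: interval_open|exact: interval_open].
  move=> ct x xp; apply: cvgV; last exact: ct.
  by rewrite gt_eqF// taupos//; move: xp; rewrite inE/= in_itv/= andbT.
have lB : locally_integrable `]0, +oo[ (fun x => B x / tau x).
  exact: locally_integrableM_continuous (B_loc_integrable hset) ctauV.
have lq : locally_integrable `]0, +oo[ q.
  have := locally_integrableD
    (locally_integrableZl lambda (continuous_locally_integrable _ ctauV)) lB.
  by congr locally_integrable; apply/funext => x; rewrite /q mulrDl.
have lbeta : locally_integrable `]0, +oo[ beta by exact: locally_integrableZl.
have q0 x : 0 < x -> 0 <= q x.
  by move=> x0; rewrite divr_ge0 ?addr_ge0 ?ltW ?Bpos ?taupos.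
have hL : has_weak_derivative L q := oriented_integral_weak_derivative ltr01 lq.
have Lnd := weak_derivative_ge0_nondecreasing hL q0.
have hphi : has_weak_derivative phi (fun x => q x * phi x - h x).
  have := phi_equation hsol; congr has_weak_derivative.
  by apply/funext => x; rewrite /q /h mulrBl mulrAC (addrC (B x)).
have hpsi := weak_derivative_integrating_factor q0 hL hphi.
have h0 x : 0 < x -> 0 <= h x.
  move=> x0; rewrite /h /dual_gain mulrAC mulr_ge0 ?Btau0//.
  exact: Rintegral_dilation_ge0 p00 (phi_gain_integrable hsol x0) x0 phi0.
have hM x M : 0 < x -> (forall y, 0 < y -> y <= x -> phi y <= M) ->
    h x <= beta x * M.
  move=> x0 phiM; rewrite /h /dual_gain mulrAC.
  have -> : beta x * M = B x / tau x * (M * m) by rewrite /beta; ring.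
  rewrite ler_wpM2l ?Btau0//.
  exact: Rintegral_dilation_le p00 (phi_gain_integrable hsol x0) x0 phiM.
have [x1 x10 phix1] : exists2 x, 0 < x & 0 < phi x.
  apply: contrapT => H.
  have phiE x : 0 < x -> phi x = 0.
    move=> x0; apply/eqP; rewrite eq_le phi0// andbT leNgt; apply/negP => phix.
    by apply: H; exists x.
  have := phi_mass hsol; rewrite (eq_integral (cst 0%E)); last first.
    by move=> x; rewrite inE/= in_itv/= andbT => x0; rewrite phiE// mulr0.
  by rewrite integral0 => /eqP; rewrite eqe eq_sym oner_eq0.
have [K [k [k0 growth]]] := phi_growth hsol.
have [x0 [x00 x01 small]] : exists x0 : R, [/\ 0 < x0, x0 <= 1 &
    forall x, 0 < x -> x <= x0 ->
      \int[lebesgue_measure]_(t in `[x, x0]) beta t <= 2^-1].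
  have bnd : \forall x \near 0^'+,
      beta x <= m * (4 * B0 / tau0) * x `^ (gamma0 - alpha0).
    have := equiv_powR_ratio_bound (B0_pos hset) (tau0_pos hset)
      (B_at0 hset) (tau_at0 hset).
    by apply: filterS => x Bx; rewrite /beta -mulrA ler_wpM2l.
  have h2 : 0 < 2^-1 :> R by rewrite invr_gt0.
  have /near_at_right0[e e0 He] :=
    Rintegral_power_bound_small (exponents_at0 hset) h2 lbeta bnd.
  have e2 : 0 < e / 2 by rewrite divr_gt0.
  exists (Num.min (e / 2) 1).
  have e3 : 0 < Num.min (e / 2) 1 by rewrite lt_min e2 ltr01.
  split => //; first by rewrite ge_min lexx orbT.
  by apply: He => //; rewrite gt_min; apply/orP; left; lra.
apply: (@nonincreasing_equiv_at0 _ phi L (2 * (phi x0 * expR (- L x0))) x0 x1) => //.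
- move=> x y x_gt0 xy; rewrite -lerN2.
  have /weak_derivative_ge0_nondecreasing : has_weak_derivative
      (fun x => - (phi x * expR (- L x))) (fun x => h x * expR (- L x)).
    have := weak_derivativeN hpsi; congr has_weak_derivative.
    by apply/funext => z; rewrite opprK.
  by apply => // z z0; rewrite mulr_ge0 ?expR_ge0 ?h0.
- apply: (@bounded_by_integrating_factor _ phi h beta L x0 (2 * K)) => //.
  + move=> x x_gt0 xx0; apply: le_trans (growth _ x_gt0) _.
    have K0 : 0 <= K.
      have := le_trans (phi0 _ x_gt0) (growth _ x_gt0).
      by rewrite pmulr_lge0// ltr_wpDr ?powR_ge0.
    rewrite mulrC ler_wpM2r// -[2]/(1 + 1) lerD2l.
    have : x `^ k <= 1 `^ k.
      by rewrite ge0_ler_powR// ?nnegrE ?(ltW x_gt0)// (le_trans xx0).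
    by rewrite powR1.
  + by move=> x x_gt0; rewrite mulr_ge0 ?Btau0.
  + (* The bound assumed up to x0 passes to (0, x] as a constant bound,
       because e^L is nondecreasing. *)
    move=> x k' a x_gt0 xx0 _ a0 H; apply: hM => // y y0 yx.
    apply: le_trans (H _ y0 (le_trans yx xx0)) _.
    by rewrite lerD2l ler_wpM2l// ler_expR Lnd.
Qed.
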